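(* Let $s\in(0,1)$ and let $\{X_n\}_{n\in\mathbb{N}}$ be a Manneville-Pomeau process with parameter $s$, $X_n=\varphi(T_s^n(U_0))$, where $\varphi\in\mathcal{L}^1(\mu_s)$ is an almost everywhere decreasing function, and let $F_0$ be the distribution function of $U_0$. Then, for any $t,h\in\mathbb{N}$ with $h\neq0$, $C_{X_0,X_h}(u,v)=C_{X_t,X_{t+h}}(u,v)$ everywhere in $I^2$, and $$C_{X_t,X_{t+h}}(u,v)=u+v-1+\left(\sum_{k=0}^{n_0-1}\big[\mathcal{F}_{h,k}(1-v)-F_0(a_{h,k})\big]\right)\delta_{\mathbb{N}^*}(n_0)+\min\big\{1-u,\mathcal{F}_{h,n_0}(1-v)\big\}-F_0(a_{h,n_0})$$ for all $(u,v)\in I^2$, where $\delta_{\mathbb{N}^*}(x)$ equals $1$ if $x\in\mathbb{N}^*$ and $0$ otherwise, $\{a_{h,k}\}_{k=0}^{2^h}$ are the end points of the nodes of $T_s^h$, and $n_0=n_0(u;h)\in\{0,\dots,2^h-1\}$ is the index $k$ for which $u\in(1-F_0(a_{h,k+1}),1-F_0(a_{h,k})]$ (with $n_0=2^h-1$ if $u=0$).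
   Context: $I=[0,1]$, $\mathbb{N}=\{0,1,2,\dots\}$, $\mathbb{N}^*=\mathbb{N}\setminus\{0\}$, $\lambda$ is Lebesgue measure on $I$. For $s>0$ the Manneville-Pomeau transformation $T_s:I\to I$ is $T_s(x)=x+x^{1+s}\ (\mathrm{mod}\ 1)$, i.e. $T_s(x)=x+x^{1+s}$ if $x+x^{1+s}<1$ and $T_s(x)=x+x^{1+s}-1$ otherwise; $T_s^k$ is its $k$-fold composition. For $s\in(0,1)$, $\mu_s$ denotes the $T_s$-invariant Borel probability measure on $I$ that is absolutely continuous with respect to $\lambda$; it is ergodic and has a positive density, so $F_0(x):=\mu_s([0,x])$ is a continuous, strictly increasing bijection of $I$. $U_0$ is a random variable with law $\mu_s$, and for $\varphi:I\to\mathbb{R}$ in $\mathcal{L}^1(\mu_s)$ the process $X_t=\varphi(T_s^t(U_0))$, $t\in\mathbb{N}$, is a Manneville-Pomeau (MP) process with parameter $s$. ''Almost everywhere decreasing'' means strictly decreasing on $I\setminus N$ for some $\lambda$-null set $N$. $C_{X,Y}$ denotes the copula of the pair of (continuous) random variables $(X,Y)$. $T_s^h$ has $2^h$ branches (maximal intervals of continuity), on each of which it is continuous and strictly increasing; $0=a_{h,0}<a_{h,1}<\dots<a_{h,2^h}=1$ are the end points of these branches, and $[a_{h,k},a_{h,k+1})$ is called the $k$-th node of $T_s^h$. $\mathcal{T}_{h,k}:I\to[a_{h,k},a_{h,k+1}]$ is the inverse of $T_s^h$ restricted to its $k$-th node (extended by continuity, so $\mathcal{T}_{h,k}(0)=a_{h,k}$,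 $\mathcal{T}_{h,k}(1)=a_{h,k+1}$). For $k=0,\dots,2^h-1$, $\mathcal{F}_{h,k}:I\to[F_0(a_{h,k}),F_0(a_{h,k+1})]$ is $\mathcal{F}_{h,k}(x)=F_0\big(\mathcal{T}_{h,k}(F_0^{-1}(x))\big)$. *)

(* Defs.v *)
From HB Require Import structures.
From mathcomp Require Import all_boot all_order all_algebra.
From mathcomp Require Import all_classical all_reals all_analysis.

Set Implicit Arguments.
Unset Strict Implicit.
Unset Printing Implicit Defensive.

Import Order.TTheory GRing.Theory Num.Theory.
Import numFieldNormedType.Exports.

Local Open Scope classical_set_scope.
Local Open Scope ring_scope.

Section copulas.
Context {R : realType}.

Definition is_copula (C : R -> R -> R) : Prop :=
  [/\ forall u v, u \in `[0, 1] -> v \in `[0, 1] -> C u v \in `[0, 1],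
      forall u, u \in `[0, 1] -> C u 0 = 0 /\ C 0 u = 0,
      forall u, u \in `[0, 1] -> C u 1 = u /\ C 1 u = u &
      forall u1 u2 v1 v2, 0 <= u1 -> u1 <= u2 -> u2 <= 1 ->
        0 <= v1 -> v1 <= v2 -> v2 <= 1 ->
        0 <= C u2 v2 - C u2 v1 - C u1 v2 + C u1 v1].

Context {d : measure_display} {Omega : measurableType d}.
Context {P : probability Omega R}.

(* Sklar's identity: the joint distribution function is the copula applied to
   the marginal ones. *)
Definition is_copula_of (X Y : {RV P >-> R}) (C : R -> R -> R) : Prop :=
  is_copula C /\
  forall x y, P [set w | X w <= x /\ Y w <= y] =
              (C (fine (cdf X x)) (fine (cdf Y y)))%:E.

(* When X and Y are continuous, is_copula_of determines C on the unit square,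
   so the choice below is immaterial there; values of C outside the square
   carry no meaning. *)
Definition copula (X Y : {RV P >-> R}) : R -> R -> R :=
  xget (fun _ _ => 0) [set C | is_copula_of X Y C].

End copulas.

Section Manneville_Pomeau.
Context {R : realType}.
Local Notation lambda := (@lebesgue_measure R).

(* Functions and measures on I = [0, 1] are represented on the whole of R, only
   their behaviour on I being relevant. *)
Local Notation I := (`[0, 1]%classic : set R).

Definition MP (s x : R) : R :=
  let y := x + x `^ (1 + s) in if y < 1 then y else y - 1.

Definition is_MP_measure (s : R) (mu : probability (measurableTypeR R) R) :
    Prop :=
  [/\ mu I = 1%E,
      mu `<< lambda &
      forall A, measurable A -> mu (I `&` MP s @^-1` A) = mu A].

Definition ae_decreasing (phi : R -> R) : Prop :=
  exists2 N, lambda.-negligible N &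
    forall x y, (I `\` N) x -> (I `\` N) y -> x < y -> phi y < phi x.

(* Maximal intervals of continuity of the h-th iterate; continuity at a point of
   J is relative to J, so J may be closed on the left. *)
Definition is_branch (s : R) (h : nat) (J : set R) : Prop :=
  [/\ is_interval J, J `<=` I, {within J, continuous (iter h (MP s))} &
      forall K : set R, is_interval K -> K `<=` I ->
        {within K, continuous (iter h (MP s))} -> J `<=` K -> K = J].

Definition are_end_points (s : R) (h : nat) (a : nat -> R) : Prop :=
  [/\ a 0%N = 0, a (2 ^ h)%N = 1,
      forall k, (k < 2 ^ h)%N -> a k < a k.+1 &
      forall k, (k < 2 ^ h)%N ->
        exists2 J, is_branch s h J & inf J = a k /\ sup J = a k.+1].

(* The end points are unique for indices 0, ..., 2 ^ h; later values of the
   sequence carry no meaning. *)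
Definition end_point (s : R) (h : nat) : nat -> R :=
  xget (fun=> 0) [set a | are_end_points s h a].

(* The continuous extension only concerns y = 1, which is not attained by the
   iterate on [a_k, a_{k+1}[ and is the limit at the right end of the node. *)
Definition inv_branch (s : R) (h k : nat) (y : R) : R :=
  let a := end_point s h in
  if y < 1 then pinv `[a k, a k.+1[%classic (iter h (MP s)) y else a k.+1.

Definition F0 (mu : probability (measurableTypeR R) R) (x : R) : R :=
  fine (mu `[0, x]%classic).

Definition F0inv (mu : probability (measurableTypeR R) R) : R -> R :=
  pinv I (F0 mu).

Definition calF (s : R) (mu : probability (measurableTypeR R) R) (h k : nat)
    (x : R) : R :=
  F0 mu (inv_branch s h k (F0inv mu x)).

Definition node_index (s : R) (mu : probability (measurableTypeR R) R)
    (h : nat) (u : R) : nat :=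
  let a := end_point s h in
  if u == 0 then (2 ^ h).-1
  else find (fun k => u \in `](1 - F0 mu (a k.+1)), (1 - F0 mu (a k))])
            (iota 0 (2 ^ h)).

Definition is_MP_process (s : R) (mu : probability (measurableTypeR R) R)
    (phi : R -> R) (d : measure_display) (Omega : measurableType d)
    (P : probability Omega R) (U0 : {RV P >-> R})
    (X : nat -> {RV P >-> R}) : Prop :=
  [/\ is_MP_measure s mu,
      forall A, measurable A -> distribution P U0 A = mu A,
      forall w, U0 w \in (`[0, 1] : interval R),
      mu.-integrable I (EFin \o phi) &
      forall n w, X n w = phi (iter n (MP s) (U0 w))].

End Manneville_Pomeau.

(* Main.v *)
Require Import Defs.
From HB Require Import structures.
From mathcomp Require Import all_boot all_order all_algebra.
From mathcomp Require Import all_classical all_reals all_analysis.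
From mathcomp Require Import measurable_realfun.
From mathcomp Require Import lra zify.

(** Let [T] be the Manneville-Pomeau map, [mu] its invariant measure, [F] the
    distribution function of [mu] and [I = [0, 1]].

    As [phi] decreases off a null set, each event [phi <= x] is, up to a null
    set, closed upwards in [I], and so are the events [1 - F <= u] and the
    intervals with right end 1. Two such sets are nested up to a null set, hence
    determined up to a null set by their measure ([upset_diff]). The variable
    [1 - F] is uniform since [mu] has no atom ([pr_upper]), so that
    [1 - F w] and [1 - F (T^h w)] have the joint distribution function
    [MP_copula], which is therefore a copula, and replacing the events
    [phi <= x] by the events [1 - F <= u] turns it into a copula of
    [phi (T^t w)] and [phi (T^(t+h) w)], the time [t] being absorbed by the
    invariance of [mu] ([MP_copula_is_copula_of]). The marginals are continuous,
    so that this copula is the only one ([copula_unique]).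

    To compute it, pick [z] and [x] with [F z = 1 - u] and [F x = 1 - v].
    Complementing both events leads to the measure of the points [w < z] with
    [T^h w < x] ([MP_copulaE]). The iterate [T^h] maps each of its nodes
    increasingly onto [[0, 1[], so that each node meets the event [T^h w < x] in
    an interval that starts at the left end of the node and stops at the inverse
    image of [x]; cutting these intervals at [z] gives the sum ([pr_box]). Only
    the values of [F] at [z] and [x] matter, so that [x] may be the preimage
    picked by the partial inverse [F0inv].

    The nodes are defined through maximal intervals of continuity. Their shape
    comes from an induction on [h]: both branches of [T] are onto, so that
    composing with [T] doubles the number of nodes ([full_branched_comp_MP]).
    At an interior cut the iterate jumps from 1 to 0, so that no interval of
    continuity crosses it; hence the nodes are exactly the maximal intervals
    of continuity ([branchE]) and the end points are unique
    ([end_points_unique]). *)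

Set Implicit Arguments.
Unset Strict Implicit.
Unset Printing Implicit Defensive.

Import Order.TTheory GRing.Theory Num.Theory.
Import numFieldNormedType.Exports.

Local Open Scope classical_set_scope.
Local Open Scope ring_scope.

(** * Nodes as maximal intervals of continuity *)

Section full_branches.
Context {R : realType}.
Implicit Types (g : R -> R) (b : nat -> R) (p q x y z : R) (N k : nat).

(** Continuity is encoded by monotonicity and surjectivity, see
    [full_node_continuous]. *)
Definition full_node g p q :=
  [/\ p < q, {in `[p, q[, forall x, 0 <= g x < 1},
      {in `[p, q[ &, {mono g : x y / x <= y}} &
      forall y, 0 <= y < 1 -> exists2 x, x \in `[p, q[ & g x = y].

Definition full_branched g N b :=
  [/\ b 0%N = 0, b N = 1, g 1 = 1 &
      forall k, (k < N)%N -> full_node g (b k) (b k.+1)].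

Lemma full_branched_mono g N b : full_branched g N b ->
  forall j k, (j <= k)%N -> (k <= N)%N -> b j <= b k.
Proof.
move=> [_ _ _ H] j k; elim: k => [|k IH]; first by rewrite leqn0 => /eqP ->.
rewrite leq_eqVlt => /orP[/eqP -> //|]; rewrite ltnS => jk kN.
have [/ltW le _ _ _] := H _ kN.
exact: le_trans (IH jk (ltnW kN)) le.
Qed.

Lemma full_branched_node g N b x : full_branched g N b -> 0 <= x < 1 ->
  exists2 k, (k < N)%N & x \in `[b k, b k.+1[.
Proof.
move=> [b0 bN _ _] /andP[x0 x1].
have: exists k, x < b k by exists N; rewrite bN.
case/ex_minnP => -[|k] xk kmin; first by rewrite b0 ltNge x0 in xk.
have bkx : b k <= x by rewrite leNgt; apply/negP => /kmin; rewrite ltnn.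
exists k; last by rewrite in_itv /= bkx.
by apply: kmin; rewrite bN.
Qed.

Lemma full_node0 g p q : full_node g p q -> g p = 0.
Proof.
move=> [pq gI gm gs].
have pp : p \in `[p, q[ by rewrite in_itv /= lexx pq.
have [|x xpq gx] := gs 0; first by rewrite lexx ltr01.
apply/eqP; rewrite eq_le; have /andP[-> _] := gI p pp.
rewrite -gx gm // andbT.
by move: xpq; rewrite in_itv => /andP[].
Qed.

(** An increasing map onto an interval is continuous; the value 1 at the right
    end makes the node closed, so that the result for segments applies. *)
Lemma full_node_continuous g p q : full_node g p q ->
  {within `[p, q], continuous (fun x => if x < q then g x else 1)}.
Proof.
move=> gpq; have g0 := full_node0 gpq; have [pq gI gm gs] := gpq.
apply: segment_inc_surj_continuous.
  move=> x y; rewrite !in_itv /= => /andP[px xq] /andP[py yq].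
  case: (ltP x q) => xq'; case: (ltP y q) => yq'.
  - by rewrite gm // in_itv /= ?px ?py.
  - have -> : y = q by apply/le_anti; rewrite yq.
    have /andP[_ /ltW ->] : 0 <= g x < 1 by apply: gI; rewrite in_itv /= px.
    by rewrite xq.
  - have -> : x = q by apply/le_anti; rewrite xq.
    have /andP[_ gy] : 0 <= g y < 1 by apply: gI; rewrite in_itv /= py.
    by rewrite leNgt gy leNgt yq'.
  - have -> : x = q by apply/le_anti; rewrite xq.
    have -> : y = q by apply/le_anti; rewrite yq.
    by rewrite !lexx.
move=> y /=; rewrite in_itv /= ltxx pq g0 => /andP[y0].
rewrite le_eqVlt => /orP[/eqP ->|y1].
  by exists q; rewrite ?ltxx //= in_itv /= ltW //= lexx.
have [|x] := gs y; first by rewrite y0.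
rewrite in_itv /= => /andP[px xq] <-.
by exists x; rewrite ?xq //= in_itv /= px ltW.
Qed.

(** As [g 1 = 1] prolongs [g] continuously at the right end of the last node,
    whereas [g] vanishes at every other right end, the last node alone is
    closed. *)
Definition node_set N b k : set R :=
  if k.+1 == N then `[b k, b k.+1]%classic else `[b k, b k.+1[%classic.

Lemma node_setW N b k x : `[b k, b k.+1[%classic x -> node_set N b k x.
Proof.
rewrite /node_set; case: ifP => // _ /=; rewrite !in_itv /=.
by move=> /andP[-> /ltW ->].
Qed.

Lemma node_set_continuous g N b k : full_branched g N b -> (k < N)%N ->
  {within node_set N b k, continuous g}.
Proof.
move=> gb kN; have [_ bN g1 H] := gb.
have sub : node_set N b k `<=` `[b k, b k.+1].
  rewrite /node_set; case: ifP => _ x //=; rewrite !in_itv /=.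
  by move=> /andP[-> /ltW ->].
have := continuous_subspaceW sub (full_node_continuous (H _ kN)).
apply: subspace_eq_continuous => x.
rewrite inE /node_set /from_subspace.
case: eqP => [kE|_] /=; rewrite in_itv /= => /andP[_ xk].
  case: (ltP x (b k.+1)) => // kx.
  have -> : x = 1 by rewrite -bN -kE; apply/le_anti; rewrite xk.
  by rewrite g1.
by rewrite xk.
Qed.

(** Approaching a cut from the left the map tends to 1, whereas it vanishes at
    the cut. *)
Lemma no_continuity_across_cut g N b k (K : set R) x : full_branched g N b ->
  (k.+1 < N)%N -> is_interval K -> {within K, continuous g} ->
  K x -> x < b k.+1 -> ~ K (b k.+1).
Proof.
move=> gb kN Kint Kc Kx xb Kb; have [_ _ _ H] := gb.
have [pq gI gm gs] := H k (ltnW kN).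
have gq := full_node0 (H _ kN).
move: Kc => /subspace_continuousP/(_ _ Kb); rewrite /from_subspace gq.
move=> /cvgrPdist_lt/(_ 2^-1)[|e /= e0]; first by rewrite invr_gt0.
set q := b k.+1 in xb Kb pq gI gm gs gq * => near_q.
have [|x0] := gs 2^-1; first by apply/andP; split; lra.
rewrite in_itv /= => /andP[px0 x0q] gx0.
pose y := Num.max (Num.max x x0) (q - e / 2).
have yq : y < q by rewrite /y !gt_max xb x0q /=; lra.
have xy : x <= y by rewrite /y !le_max lexx.
have x0y : x0 <= y by rewrite /y !le_max lexx orbT.
have ey : q - e / 2 <= y by rewrite /y !le_max lexx !orbT.
have Ky : K y by apply: (Kint x q) => //; rewrite xy ltW.
have : 2^-1 <= g y.
  by rewrite -gx0 gm // in_itv /= ?px0 ?x0q ?yq ?(le_trans px0).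
have := near_q y; rewrite /= ger0_norm; last by rewrite subr_ge0 ltW.
have -> : (q - y < e) by lra.
by move=> /(_ isT Ky); rewrite sub0r normrN => /ltr_normlP[_ ?]; lra.
Qed.

Lemma node_set_interval N b k : is_interval (node_set N b k).
Proof. by rewrite /node_set; case: ifP => _; exact: interval_is_interval. Qed.

Lemma full_branched_unit g N b k : full_branched g N b -> (k <= N)%N ->
  0 <= b k <= 1.
Proof.
move=> gb kN; have [b0 bN _ _] := gb.
by rewrite -{1}b0 -bN !(full_branched_mono gb).
Qed.

Lemma node_set_unit g N b k : full_branched g N b -> (k < N)%N ->
  node_set N b k `<=` `[0, 1].
Proof.
move=> gb kN x Kx.
have : x \in `[b k, b k.+1].
  move: Kx; rewrite /node_set; case: ifP => _ //=; rewrite !in_itv /=.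
  by move=> /andP[-> /ltW].
have /andP[b0 _] := full_branched_unit gb (ltnW kN).
have /andP[_ b1] := full_branched_unit gb kN.
by rewrite /= !in_itv /= => /andP[/(le_trans b0) -> /le_trans ->].
Qed.

(** Leaving the node would mean crossing one of its ends, which is either an
    interior cut or an end of [[0, 1]]. *)
Lemma continuity_in_node g N b k (K : set R) x : full_branched g N b ->
  (k < N)%N -> is_interval K -> K `<=` `[0, 1] -> {within K, continuous g} ->
  K x -> b k < x < b k.+1 -> K `<=` node_set N b k.
Proof.
move=> gb kN Kint KI Kc Kx /andP[kx xk] y Ky.
have [b0 bN _ _] := gb.
have := KI _ Ky; rewrite /= in_itv /= => /andP[y0 y1].
have ky : b k <= y.
  case: k kN kx xk => [|k] kN kx xk; first by rewrite b0.
  rewrite leNgt; apply/negP => yk.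
  apply: (no_continuity_across_cut gb kN Kint Kc Ky yk).
  by apply: (Kint y x) => //; rewrite !ltW.
rewrite /node_set; case: eqP => [kE|kE] /=; rewrite in_itv /= ky /=.
  by rewrite kE bN.
have kN' : (k.+1 < N)%N by rewrite ltn_neqAle kN andbT; apply/eqP.
rewrite ltNge; apply/negP => yk.
apply: (no_continuity_across_cut gb kN' Kint Kc Kx xk).
by apply: (Kint x y) => //; rewrite yk ltW.
Qed.

End full_branches.

Section end_points.
Context {R : realType} (s : R) (h : nat).
Implicit Types (b : nat -> R) (k : nat) (J : set R).
Local Notation g := (iter h (MP s)).

(** A larger interval of continuity meets the interior of the node, hence cannot
    leave it. *)
Lemma node_set_branch b k : full_branched g (2 ^ h) b -> (k < 2 ^ h)%N ->
  is_branch s h (node_set (2 ^ h) b k).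
Proof.
move=> gb kN; split.
- exact: node_set_interval.
- exact: node_set_unit gb kN.
- exact: node_set_continuous gb kN.
move=> K Kint KI Kc sub; apply/seteqP; split=> //.
have [_ _ _ /(_ _ kN)[pq _ _ _]] := gb.
pose x := (b k + b k.+1) / 2.
have xk : b k < x < b k.+1 by rewrite /x; apply/andP; split; lra.
apply: (continuity_in_node gb kN Kint KI Kc _ xk).
by apply/sub/node_setW => /=; rewrite in_itv /=; case/andP: xk => /ltW -> ->.
Qed.

(** A branch with interior has a point in the interior of some node; it lies
    within this node, hence is equal to it by maximality. *)
Lemma branchE b J : full_branched g (2 ^ h) b -> is_branch s h J ->
  inf J < sup J ->
  exists2 k, (k < 2 ^ h)%N & J = node_set (2 ^ h) b k.
Proof.
move=> gb [Jint JI Jc Jmax] infsup.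
have J0 : J !=set0.
  by apply/set0P/eqP => J0; rewrite J0 inf0 sup0 ltxx in infsup.
have Jub : has_sup J.
  by split=> //; exists 1 => x /JI /=; rewrite in_itv /= => /andP[].
have Jlb : has_inf J.
  by split=> //; exists 0 => x /JI /=; rewrite in_itv /= => /andP[].
have [e Je eP] : exists2 e, J e & (inf J + sup J) / 2 < e.
  have [|e Je] := @sup_adherent _ J ((sup J - inf J) / 2) _ Jub; first lra.
  by exists e => //; lra.
have [e' Je' eP'] : exists2 e, J e & e < (inf J + sup J) / 2.
  have [|e' Je'] := @inf_adherent _ J ((sup J - inf J) / 2) _ Jlb; first lra.
  by exists e' => //; lra.
have ee' : e' < e by lra.
have := JI _ Je'; have := JI _ Je; rewrite /= !in_itv /= => /andP[_ e1] /andP[e0' _].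
have [|k kN] := @full_branched_node _ _ _ _ e' gb; first by rewrite e0' /=; lra.
rewrite in_itv /= => /andP[ke ek].
have [_ _ _ /(_ _ kN)[pq _ _ _]] := gb.
(* [e'] may be the left end of its node: a point slightly to its right is both
   in [J] and in the interior of the node *)
pose x := (e' + Num.min e (b k.+1)) / 2.
have ex : e' < x by rewrite /x ltr_pdivlMr // mulr_natr mulr2n ltrD2l lt_min ee' ek.
have xm : x < Num.min e (b k.+1).
  by rewrite /x ltr_pdivrMr // mulr_natr mulr2n ltrD2r lt_min ee' ek.
move: (xm); rewrite lt_min => /andP[xe xk].
have Jx : J x by apply: (Jint e' e) => //; rewrite !ltW.
exists k => //; apply/esym/Jmax.
- exact: node_set_interval.
- exact: node_set_unit gb kN.
- exact: node_set_continuous gb kN.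
apply: (continuity_in_node gb kN Jint JI Jc Jx).
by rewrite xk (le_lt_trans ke ex).
Qed.

Lemma node_set_inf b k : b k < b k.+1 -> inf (node_set (2 ^ h) b k) = b k.
Proof.
by move=> bk; rewrite /node_set; case: ifP => _; rewrite inf_itv ?bnd_simp // ltW.
Qed.

Lemma node_set_sup b k : b k < b k.+1 -> sup (node_set (2 ^ h) b k) = b k.+1.
Proof.
by move=> bk; rewrite /node_set; case: ifP => _; rewrite sup_itv ?bnd_simp // ltW.
Qed.

Lemma full_branched_end_points b : full_branched g (2 ^ h) b ->
  are_end_points s h b.
Proof.
move=> gb; have [b0 bN _ H] := gb; split=> // k kN.
  by have [] := H _ kN.
exists (node_set (2 ^ h) b k); first exact: node_set_branch.
by have [pq _ _ _] := H _ kN; rewrite node_set_inf ?node_set_sup.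
Qed.

(** Each pair of consecutive end points bounds a node; starting from 0, this
    leaves no choice. *)
Lemma end_points_unique a b : full_branched g (2 ^ h) b ->
  are_end_points s h a -> forall k, (k <= 2 ^ h)%N -> a k = b k.
Proof.
move=> gb [a0 aN alt aJ]; have [b0 bN _ H] := gb.
elim=> [|k IH] kN; first by rewrite a0 b0.
have [J Jb [Jinf Jsup]] := aJ _ kN.
have [|j jN JE] := branchE gb Jb; first by rewrite Jinf Jsup alt.
have [bj _ _ _] := H _ jN.
move: Jinf Jsup; rewrite JE node_set_inf // node_set_sup // IH; last exact: ltnW.
move=> bjk <-; congr b; congr S.
have [jk|kj|//] := ltngtP j k.
  have := full_branched_mono gb jk (ltnW kN).
  by rewrite -bjk leNgt bj.
have [bk _ _ _] := H _ kN.
have := full_branched_mono gb kj (ltnW jN).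
by rewrite bjk leNgt bk.
Qed.

Lemma end_point_full_branched : (exists b, full_branched g (2 ^ h) b) ->
  full_branched g (2 ^ h) (end_point s h).
Proof.
move=> [b gb]; have ex_end := ex_intro _ b (full_branched_end_points gb).
have := end_points_unique gb (xgetPex (fun=> 0) ex_end).
rewrite -/(end_point s h) => E; have [b0 bN g1 H] := gb.
split=> //; rewrite ?E // => k kN; rewrite !E //; first exact: H.
exact: ltnW.
Qed.

End end_points.

(** * Branches of the iterates of the Manneville-Pomeau map *)

Section Manneville_Pomeau_branches.
Context {R : realType} (s : R) (hs : 0 < s).
Implicit Types (x y : R).

Let r := 1 + s.
Let r0 : 0 < r. Proof. by rewrite addr_gt0. Qed.

Definition MP_lift x := x + x `^ (1 + s).

Lemma MP_lift0 : MP_lift 0 = 0.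
Proof. by rewrite /MP_lift powR0 ?addr0 // gt_eqF. Qed.

Lemma MP_lift1 : MP_lift 1 = 2.
Proof. by rewrite /MP_lift powR1. Qed.

Lemma ler_MP_lift : {in `[0, 1] &, {mono MP_lift : x y / x <= y}}.
Proof.
apply: le_mono_in => x y; rewrite !in_itv /= => /andP[x0 _] /andP[y0 _] xy.
by apply: ltrD => //; apply: gt0_ltr_powR; rewrite ?nnegrE.
Qed.

Lemma MP_lift_range x : 0 <= x <= 1 -> 0 <= MP_lift x <= 2.
Proof.
move=> xI; rewrite -{1}MP_lift0 -MP_lift1 !ler_MP_lift //.
all: by rewrite in_itv /= ?lexx ?ler01.
Qed.

(** The inverse power shows that the power is onto, and an increasing map onto a
    segment is continuous. *)
Lemma powR_segment_continuous : {within `[0, 1], continuous (fun x : R => x `^ r)}.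
Proof.
apply: segment_inc_surj_continuous.
  apply: le_mono_in => x y; rewrite !in_itv /= => /andP[x0 _] /andP[y0 _] xy.
  by apply: gt0_ltr_powR; rewrite ?nnegrE.
move=> y /=; rewrite powR1 powR0 ?gt_eqF // in_itv /= => /andP[y0 y1].
exists (y `^ r^-1); last by rewrite -powRrM mulVf ?gt_eqF // powRr1.
rewrite /= in_itv /= powR_ge0 /=.
have -> : 1 = 1 `^ r^-1 :> R by rewrite powR1.
by apply: ge0_ler_powR; rewrite ?nnegrE ?invr_ge0 // ltW.
Qed.

Lemma MP_lift_surj y : 0 <= y <= 2 -> exists2 x, 0 <= x <= 1 & MP_lift x = y.
Proof.
move=> /andP[y0 y2].
have [||x] := @IVT _ MP_lift 0 1 y ler01.
- have -> : MP_lift = id + (fun x => x `^ r) by exact/funext.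
  apply: within_continuousD; last exact: powR_segment_continuous.
  by apply: continuous_subspaceT => x; exact: cvg_id.
- by rewrite MP_lift0 MP_lift1 min_l ?max_r //; lra.
by rewrite in_itv /= => ? ?; exists x.
Qed.

Lemma MP1 : MP s 1 = 1.
Proof. by rewrite /MP -/(MP_lift 1) MP_lift1; case: (ltP 2 1); lra. Qed.

Lemma MP_unit x : 0 <= x <= 1 -> 0 <= MP s x <= 1.
Proof.
move=> /MP_lift_range; rewrite /MP -/(MP_lift x).
by case: (ltP (MP_lift x) 1); lra.
Qed.

Lemma iter_MP_unit h x : 0 <= x <= 1 -> 0 <= iter h (MP s) x <= 1.
Proof. by move=> xI; elim: h => //= h; exact: MP_unit. Qed.

Definition double_cuts (N : nat) (b : nat -> R) (k : nat) : R :=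
  if (k < N)%N then b k else 1 + b (k - N)%N.

(** Both branches of the map are onto, so that composing on the right with it
    duplicates the nodes: the cuts of [g \o MP s] are the preimages under the
    lift [x + x `^ (1 + s)] of those of [g] and of their translates by 1. *)
Lemma full_branched_comp_MP (g : R -> R) N b : full_branched g N b ->
  exists b', full_branched (g \o MP s) (N + N) b'.
Proof.
move=> gb; have [b0 bN g1 H] := gb.
have N0 : (0 < N)%N.
  by case: N bN {gb H} => // bN; have := oner_neq0 R; rewrite -bN b0 eqxx.
pose B := double_cuts N b.
have BI k : (k <= N + N)%N -> 0 <= B k <= 2.
  move=> kN; rewrite /B /double_cuts; case: ltnP => kN'.
    by have := full_branched_unit gb (ltnW kN'); lra.
  have kN1 : (k - N <= N)%N by rewrite leq_subLR.
  by have := full_branched_unit gb kN1; lra.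
pose b' k := xget 0 [set x | 0 <= x <= 1 /\ MP_lift x = B k].
have b'P k : (k <= N + N)%N -> 0 <= b' k <= 1 /\ MP_lift (b' k) = B k.
  move=> /BI /MP_lift_surj[x xI xB].
  by apply: (@xgetPex _ 0 [set x | 0 <= x <= 1 /\ MP_lift x = B k]); exists x.
have MPI x y : 0 <= x <= 1 -> 0 <= y <= 1 -> (MP_lift x <= MP_lift y) = (x <= y).
  by move=> xI yI; rewrite ler_MP_lift // in_itv.
have MPIlt x y : 0 <= x <= 1 -> 0 <= y <= 1 -> (MP_lift x < MP_lift y) = (x < y).
  by move=> xI yI; rewrite ltNge MPI // -ltNge.
have MPinj x y : 0 <= x <= 1 -> 0 <= y <= 1 -> MP_lift x = MP_lift y -> x = y.
  by move=> xI yI E; apply/le_anti; rewrite -(MPI x y) // -(MPI y x) // E lexx.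
have b'node k : (k < N + N)%N -> forall x, x \in `[b' k, b' k.+1[ ->
    (0 <= x <= 1) /\ B k <= MP_lift x < B k.+1.
  move=> kN x; rewrite in_itv /= => /andP[kx xk].
  have [kI kE] := b'P k (ltnW kN); have [k1I k1E] := b'P _ kN.
  have xI : 0 <= x <= 1 by lra.
  by rewrite xI -kE -k1E MPI // MPIlt // kx xk.
have b'node' k : (k < N + N)%N -> forall y, B k <= y < B k.+1 ->
    exists2 x, x \in `[b' k, b' k.+1[ & (0 <= x <= 1) /\ MP_lift x = y.
  move=> kN y /andP[ky yk].
  have [kI kE] := b'P k (ltnW kN); have [k1I k1E] := b'P _ kN.
  have [|x xI xE] := @MP_lift_surj y.
    by have := BI _ (ltnW kN); have := BI _ kN; lra.
  by exists x => //; rewrite in_itv /= -MPI // -MPIlt // xE kE k1E ky.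
(* [c] is the integer part of the lift on the node, [j] the node of [g] hit *)
have key k : (k < N + N)%N -> exists j c, [/\ (j < N)%N,
    B k = c + b j, B k.+1 = c + b j.+1 & forall x, 0 <= x <= 1 ->
      B k <= MP_lift x < B k.+1 -> MP s x = MP_lift x - c].
  move=> kN; rewrite /B /double_cuts; case: (ltnP k N) => kN'.
    have Bk1 : (if (k.+1 < N)%N then b k.+1 else 1 + b (k.+1 - N)%N) = b k.+1.
      case: ltnP => // ?; have -> : k.+1 = N by lia.
      by rewrite subnn b0 bN addr0.
    exists k, 0; rewrite !add0r Bk1; split=> // x _ /andP[_ xk].
    rewrite /MP -/(MP_lift x) subr0.
    have /andP[_ b1] := full_branched_unit gb kN'.
    by rewrite (lt_le_trans xk b1).
  rewrite ltnNge (leqW kN') /= subSn //.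
  have jN : (k - N < N)%N by lia.
  exists (k - N)%N, 1; split=> // x _ /andP[kx _].
  rewrite /MP -/(MP_lift x).
  have := full_branched_unit gb (ltnW jN).
  by case: (ltP (MP_lift x) 1); lra.
exists b'; split.
- have [//|bI bE] := b'P 0%N.
  apply: MPinj => //; first by rewrite lexx ler01.
  by rewrite bE MP_lift0 /B /double_cuts N0 b0.
- have [//|bI bE] := b'P (N + N)%N.
  apply: MPinj => //; first by rewrite lexx ler01.
  by rewrite bE MP_lift1 /B /double_cuts ltnNge leq_addr /= addnK bN; lra.
- by rewrite /= MP1.
move=> k kN; have [j [c [jN Bk Bk1 MPE]]] := key k kN.
have [bj gI gm gs] := H _ jN.
have Tnode x : x \in `[b' k, b' k.+1[ ->
    [/\ 0 <= x <= 1, MP s x = MP_lift x - c & MP s x \in `[b j, b j.+1[].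
  move=> /(b'node _ kN)[xI xB]; split=> //; first exact: MPE.
  by rewrite MPE // in_itv /=; move: xB; rewrite Bk Bk1; lra.
have [kI kE] := b'P k (ltnW kN); have [k1I k1E] := b'P _ kN.
split.
- by rewrite -MPIlt // kE k1E Bk Bk1; lra.
- by move=> x /Tnode[_ _ /gI].
- move=> x y /Tnode[xI xE xn] /Tnode[yI yE yn] /=.
  by rewrite gm // xE yE lerD2r MPI.
- move=> y /gs[z]; rewrite in_itv /= => zj <-.
  have [|x xk [xI xE]] := b'node' _ kN (c + z); first by rewrite Bk Bk1; lra.
  exists x => //=; congr g; have [_ -> _] := Tnode _ xk.
  by rewrite xE; lra.
Qed.

Lemma full_branched_iter_MP h :
  exists b, full_branched (iter h (MP s)) (2 ^ h) b.
Proof.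
elim: h => [|h [b /full_branched_comp_MP[b' gb']]].
  exists (fun k => k%:R); split=> // k; rewrite expn0 ltnS leqn0 => /eqP ->.
  by split=> //= y yI; exists y.
exists b'; rewrite expnS mul2n -addnn.
have -> // : iter h.+1 (MP s) = iter h (MP s) \o MP s.
by apply/funext => x; rewrite iterSr.
Qed.

Lemma end_point_full h : full_branched (iter h (MP s)) (2 ^ h) (end_point s h).
Proof. exact/end_point_full_branched/full_branched_iter_MP. Qed.

(** The inverse branches enter the computation of measures through this
    comparison only; for [y = 1] the right end of the node makes both sides
    true on the whole node. *)
Lemma inv_branchP h k y : (k < 2 ^ h)%N -> 0 <= y <= 1 ->
  let a := end_point s h in
  a k <= inv_branch s h k y <= a k.+1 /\
  {in `[a k, a k.+1[, forall w, (iter h (MP s) w < y) = (w < inv_branch s h k y)}.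
Proof.
move=> kN /andP[y0 y1] a; have [_ _ _ /(_ _ kN)[pq gI gm gs]] := end_point_full h.
rewrite /inv_branch; case: ltP => y1'; last first.
  rewrite -/a lexx ltW //; split=> // w wk.
  have /andP[_ gw] := gI w wk; rewrite (lt_le_trans gw y1').
  by move: wk; rewrite in_itv /= => /andP[_ ->].
rewrite -/a; set A := `[a k, a k.+1[%classic; set g := iter h _.
have yA : (g @` A) y by have [|x xA <-] := gs y; [rewrite y0 y1'|exists x].
have gp : g (pinv A g y) = y by rewrite pinvK ?inE.
have : A (pinv A g y).
  have sA : set_surj A [set y] g by move=> _ ->.
  by apply: (surjpinv_image_sub sA); exists y.
rewrite /A /= => pA; split.
  by move: pA; rewrite in_itv /= => /andP[-> /ltW ->].
by move=> w wk; rewrite -{1}gp !ltNge gm.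
Qed.

End Manneville_Pomeau_branches.

(** * Probabilities, quantiles and uniqueness of copulas *)

Section probability_of_sets.
Context {d : measure_display} {T : measurableType d} {R : realType}.
Context (P : probability T R).
Implicit Types A B : set T.

(** Real-valued, so that additivity can be exploited by linear arithmetic. *)
Definition pr A : R := fine (P A).

Lemma prE A : measurable A -> P A = (pr A)%:E.
Proof. by move=> mA; rewrite fineK ?fin_num_measure. Qed.

Lemma pr_ge0 A : 0 <= pr A.
Proof. by rewrite fine_ge0. Qed.

Lemma le_pr A B : measurable A -> measurable B -> A `<=` B -> pr A <= pr B.
Proof. by move=> mA mB AB; rewrite -lee_fin -!prE // le_measure ?inE. Qed.

Lemma prDI A B : measurable A -> measurable B ->
  pr A = pr (A `\` B) + pr (A `&` B).
Proof.
move=> mA mB; apply: EFin_inj; rewrite EFinD -!prE ?(measureDI _ mA mB) //.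
- exact: measurableI.
- exact: measurableD.
Qed.

Lemma prD A B : measurable A -> measurable B -> A `<=` B ->
  pr (B `\` A) = pr B - pr A.
Proof. by move=> mA mB AB; rewrite (prDI mB mA) (setIidr AB) addrK. Qed.

Lemma prU A B : measurable A -> measurable B -> A `&` B = set0 ->
  pr (A `|` B) = pr A + pr B.
Proof.
move=> mA mB AB; apply: EFin_inj; rewrite EFinD -!prE ?measureU //.
exact: measurableU.
Qed.

(** By symmetry one inequality is enough: what [A `&` B] has outside
    [A' `&` B'] lies in the union of two of the null differences. *)
Lemma pr_ae A A' B B' : measurable A -> measurable A' -> measurable B ->
  measurable B' -> pr (A `\` A') = 0 -> pr (A' `\` A) = 0 ->
  pr (B `\` B') = 0 -> pr (B' `\` B) = 0 -> pr (A `&` B) = pr (A' `&` B').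
Proof.
move=> mA mA' mB mB' A0 A'0 B0 B'0.
have half C C' D D' : measurable C -> measurable C' -> measurable D ->
    measurable D' -> pr (C `\` C') = 0 -> pr (D `\` D') = 0 ->
    pr (C `&` D) <= pr (C' `&` D').
  move=> mC mC' mD mD' C0 D0.
  have mCD : measurable (C `&` D) by exact: measurableI.
  have mCD' : measurable (C' `&` D') by exact: measurableI.
  rewrite (prDI mCD mCD') -[leRHS]add0r; apply: lerD; last first.
    by apply: le_pr => //; first exact: measurableI.
  have -> : 0 = pr (C `\` C') + pr (D `\` D') by rewrite C0 D0 addr0.
  have mC1 : measurable (C `\` C') by exact: measurableD.
  have mD1 : measurable (D `\` D') by exact: measurableD.
  rewrite -lee_fin EFinD -!prE //; last exact: measurableD.
  apply: le_trans (measureU2 _ mC1 mD1).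
  apply: le_measure; rewrite ?inE; [exact: measurableD|exact: measurableU|].
  move=> x [[Cx Dx] nx]; have [C'x|nC'x] := pselect (C' x); last by left.
  by right; split=> // D'x; exact: nx.
by apply/le_anti; rewrite !half.
Qed.

End probability_of_sets.

Section quantiles.
Context {R : realType} {d : measure_display} {Omega : measurableType d}.
Context {P : probability Omega R}.
Implicit Types X Y : {RV P >-> R}.

Definition rcdf X (x : R) : R := fine (cdf X x).

Definition atomless X := forall x, P (X @^-1` [set x]) = 0%E.

Lemma cdfE X x : cdf X x = (rcdf X x)%:E.
Proof. by rewrite /rcdf fineK ?fin_num_measure. Qed.

Lemma rcdf_ge0 X x : 0 <= rcdf X x.
Proof. by rewrite -lee_fin -cdfE cdf_ge0. Qed.

Lemma rcdf_le1 X x : rcdf X x <= 1.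
Proof. by rewrite -lee_fin -cdfE cdf_le1. Qed.

Lemma rcdf_le X x y : x <= y -> rcdf X x <= rcdf X y.
Proof. by move=> xy; rewrite -lee_fin -!cdfE cdf_nondecreasing. Qed.

(** The infimum [z] of the points where the distribution function reaches [p]:
    right continuity gives at least [p] at [z], and the absence of an atom at
    [z] gives at most [p]. *)
Lemma quantile X p : atomless X -> 0 < p -> (exists x, p <= rcdf X x) ->
  exists2 z, rcdf X z = p & forall x, (rcdf X x < p) = (x < z).
Proof.
move=> X0 p0 [x0 px0]; pose E := [set x | p <= rcdf X x].
have E0 : E !=set0 by exists x0.
have Elb : has_inf E.
  split=> //.
  have : \forall x \near -oo, rcdf X x < p.
    exact: (cvgr_lt _ (fine_cvg (cvg_cdfNy0 X))).
  case=> y [_ yP]; exists (y - 1) => x Ex; rewrite leNgt; apply/negP => xy.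
  have : rcdf X x < p by apply: yP; lra.
  by rewrite ltNge (Ex : is_true (p <= _)).
pose z := inf E.
have ltz x : x < z -> rcdf X x < p.
  move=> xz; rewrite ltNge; apply/negP => Ex.
  by have := ge_inf (proj2 Elb) (Ex : E x); rewrite leNgt xz.
have gtz x : z < x -> p <= rcdf X x.
  move=> xz; have [|e Ee ez] := @inf_adherent _ E (x - z) _ Elb; first by lra.
  apply: (le_trans (Ee : is_true (p <= _))); apply: rcdf_le.
  by rewrite /z in xz ez *; lra.
have pz : p <= rcdf X z.
  rewrite -lee_fin -cdfE.
  apply: (cvge_ge _ (@cdf_right_continuous _ _ _ _ X z)).
  near=> x; rewrite cdfE lee_fin; apply: gtz; near: x; exact: nbhs_right_gt.
have zp : rcdf X z <= p.
  pose F n := X @^-1` `]-oo, z - n.+1%:R^-1]%classic.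
  have mF n : measurable (F n) by exact: measurable_funPTI.
  have mUF : measurable (\bigcup_n F n) by apply: bigcup_measurable => n _.
  have -> : rcdf X z = pr P (\bigcup_n F n).
    apply: EFin_inj; rewrite -cdfE -[RHS]prE // /cdf /distribution /pushforward.
    have -> : \bigcup_n F n = X @^-1` `]-oo, z[%classic.
      apply/seteqP; split => w /=; rewrite in_itv /=.
        case=> n _; rewrite /F /= in_itv /= => /le_lt_trans; apply.
        by rewrite ltrBlDr ltrDl invr_gt0.
      move=> /ltr_add_invr[n nz]; exists n => //; rewrite /F /= in_itv /=.
      by rewrite ltW // ltrBrDr.
    rewrite -(@setUitv1 _ _ _ _ true) //.
    rewrite preimage_setU measureU0 //; last exact: X0.
    exact: measurable_funPTI.
  rewrite -lee_fin -prE; last exact: mUF.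
  have cF : P \o F @ \oo --> P (\bigcup_n F n).
    apply: nondecreasing_cvg_mu => //.
    move=> n m nm; apply/subsetPset => w /=; rewrite /F /= !in_itv /=.
    move=> /le_trans; apply.
    by rewrite lerD2l lerN2 lef_pV2 ?posrE // ler_nat.
  apply: (cvge_le _ cF); near=> n => /=.
  by rewrite -[P _]/(cdf X _) cdfE lee_fin ltW // ltz // ltrBlDr ltrDl invr_gt0.
exists z; first by apply/le_anti; rewrite zp pz.
move=> x; case: (ltP x z) => xz; first exact: ltz.
by apply/negbTE; rewrite -leNgt (le_trans pz) // rcdf_le.
Unshelve. all: by end_near.
Qed.

Lemma quantile_lt1 X p : atomless X -> 0 < p < 1 ->
  exists z, rcdf X z = p.
Proof.
move=> X0 /andP[p0 p1].
have [|z zp _] := @quantile X p X0 p0; last by exists z.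
have : \forall x \near +oo, p < rcdf X x.
  exact: (cvgr_gt _ (fine_cvg (cvg_cdfy1 X))).
case=> y [_ yP]; exists (y + 1); rewrite ltW //.
by apply: yP; lra.
Qed.

(** All copulas agree on the boundary of the square; inside it, the continuous
    marginals attain every level, so that Sklar's identity determines the
    copula. *)
Lemma copula_unique X Y C C' : atomless X -> atomless Y ->
  is_copula_of X Y C -> is_copula_of X Y C' ->
  forall u v, u \in `[0, 1] -> v \in `[0, 1] -> C u v = C' u v.
Proof.
move=> X0 Y0 [[_ C0 C1 _] CE] [[_ C'0 C'1 _] C'E] u v uI vI.
have [->|u0] := eqVneq u 0; first by rewrite (C0 _ vI).2 (C'0 _ vI).2.
have [->|v0] := eqVneq v 0; first by rewrite (C0 _ uI).1 (C'0 _ uI).1.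
have [->|u1] := eqVneq u 1; first by rewrite (C1 _ vI).2 (C'1 _ vI).2.
have [->|v1] := eqVneq v 1; first by rewrite (C1 _ uI).1 (C'1 _ uI).1.
move: uI vI; rewrite !in_itv /= => uI vI.
have [|x xu] := quantile_lt1 X0 (p := u).
  by rewrite !lt_neqAle eq_sym u0 u1.
have [|y yv] := quantile_lt1 Y0 (p := v).
  by rewrite !lt_neqAle eq_sym v0 v1.
apply: EFin_inj; rewrite -xu -yv.
by rewrite -[LHS]CE -[RHS]C'E.
Qed.

Lemma copulaE X Y C : atomless X -> atomless Y -> is_copula_of X Y C ->
  forall u v, u \in `[0, 1] -> v \in `[0, 1] -> copula X Y u v = C u v.
Proof.
move=> X0 Y0 CXY; apply: (copula_unique X0 Y0 _ CXY).
by apply: (@xgetPex _ (fun _ _ => 0) [set D | is_copula_of X Y D]); exists C.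
Qed.

End quantiles.

(** * The invariant measure *)

Section invariant_measure.
Context {R : realType} (s : R) (hs : 0 < s).
Context (mu : probability (measurableTypeR R) R) (hmu : is_MP_measure s mu).
Local Notation I := (`[0, 1]%classic : set R).
Local Notation lambda := (@lebesgue_measure R).
Local Notation F := (F0 mu).
Local Notation measurableR := (@measurable _ (measurableTypeR R)).
Implicit Types (A B : set R) (x y z u v w p q : R) (h k n : nat).

Let mI : measurableR I.
Proof. exact: measurable_itv. Qed.

Lemma measurable_iter_MP h : measurable_fun [set: measurableTypeR R]
  (iter h (MP s) : measurableTypeR R -> measurableTypeR R).
Proof.
elim: h => [|h IH] /=; first exact: measurable_id.
have mf : measurable_fun [set: measurableTypeR R]
    (fun x : measurableTypeR R => x + x `^ (1 + s) : measurableTypeR R).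
  by apply: measurable_funD => //; exact: measurable_powR.
apply: (@measurableT_comp _ _ _ _ _ _
  (MP s : measurableTypeR R -> measurableTypeR R)) IH.
apply: measurable_fun_ifT => //.
- by apply: measurable_fun_ltr => //; exact: measurable_cst.
- by apply: measurable_funB => //; exact: measurable_cst.
Qed.

(** Restricted to [I], the only points where the map is meaningful. *)
Definition at_time h A : set R := I `&` iter h (MP s) @^-1` A.

Lemma measurable_at_time h A : measurableR A -> measurableR (at_time h A).
Proof.
move=> mA; apply: measurableI => //; rewrite -[_ @^-1` _]setTI.
exact: measurable_iter_MP.
Qed.

Lemma mu_I A : measurableR A -> mu (I `&` A) = mu A.
Proof.
move=> mA; have [muI _ _] := hmu.
have mCI : measurableR (~` I) by exact: measurableC.
have nI : mu (~` I) = 0%E by rewrite probability_setC // muI subee.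
have mAI : measurableR (A `\` I) by exact: measurableD.
rewrite [RHS](measureDI mu mA mI) setIC [X in (X + _)%E](_ : _ = 0%E) ?add0e //.
by apply: (subset_measure0 mAI mCI) nI => x [].
Qed.

(** For [h = 0] the claim is that [mu] is carried by [I]; for larger [h] it
    follows from the invariance under the map itself, as [I] is stable. *)
Lemma mu_at_time h A : measurableR A -> mu (at_time h A) = mu A.
Proof.
move=> mA; elim: h => [|h IH]; first exact: mu_I.
have [_ _ inv] := hmu.
rewrite -IH -(inv (at_time h A)); last exact: measurable_at_time.
congr (mu _); apply/seteqP; split => x /= [xI].
  rewrite /at_time /= -iterS iterSr => xA; split=> //; split=> //=.
  by move: xI; rewrite /= !in_itv /=; exact: MP_unit.
by rewrite /at_time /= => -[_ xA]; split=> //; rewrite /= -iterS iterSr.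
Qed.

Local Notation pr := (pr mu).

Lemma pr_at_time h A : measurableR A -> pr (at_time h A) = pr A.
Proof. by move=> mA; rewrite /pr mu_at_time. Qed.

Lemma prI : pr I = 1.
Proof. by have [muI _ _] := hmu; rewrite /pr muI. Qed.

Lemma mu_null A : measurableR A -> lambda A = 0%E -> mu A = 0%E.
Proof. by have [_ /null_content_dominatesP dom _] := hmu; exact: dom. Qed.

Lemma mu_set1 x : mu [set x] = 0%E.
Proof. by apply: mu_null; [exact: measurable_set1|exact: lebesgue_measure_set1]. Qed.

(* [mu] is the law of the identity, so that [quantile] applies to it. *)
Let idR : measurableTypeR R -> R := idfun.

#[local] HB.instance Definition _ :=
  @isMeasurableFun.Build _ _ _ _ idR (@measurable_id _ _ setT).

Lemma F0_rcdf x : F x = rcdf (idR : {RV mu >-> R}) x.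
Proof.
rewrite /F0 /rcdf /cdf /distribution /pushforward /= preimage_id.
case: (leP x 1) => x1.
  rewrite -(@mu_I `]-oo, x]%classic) //.
  congr (fine (mu _)); apply/seteqP; split => y /=; rewrite !in_itv /=.
    by move=> /andP[-> yx]; rewrite yx (le_trans yx).
  by case=> /andP[->].
rewrite -(@mu_I `]-oo, x]%classic) // -(@mu_I `[0, x]%classic) //.
congr (fine (mu _)); apply/seteqP; split => y /=; rewrite !in_itv /=.
  by case=> /andP[-> ->] /andP[_ ->].
by case=> /andP[-> ->] ->.
Qed.

Lemma F0_ge0 x : 0 <= F x.
Proof. by rewrite F0_rcdf rcdf_ge0. Qed.

Lemma F0_le1 x : F x <= 1.
Proof. by rewrite F0_rcdf rcdf_le1. Qed.

Lemma F0_le x y : x <= y -> F x <= F y.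
Proof. by rewrite !F0_rcdf; exact: rcdf_le. Qed.

Lemma F0_1 : F 1 = 1.
Proof. exact: prI. Qed.

Lemma F0_0 : F 0 = 0.
Proof. by rewrite /F0 set_itv1 mu_set1. Qed.

(** The case [p = 0] is apart: the infimum of the points where the distribution
    function of [mu] is nonnegative would be infinite. *)
Lemma F0_quantile p : 0 <= p <= 1 ->
  exists z, [/\ 0 <= z <= 1, F z = p &
    forall w, 0 <= w -> (F w < p) = (w < z)].
Proof.
move=> /andP[]; rewrite le_eqVlt => /orP[/eqP <- _|p0 p1].
  exists 0; split; rewrite ?lexx ?ler01 ?F0_0 // => w w0.
  by rewrite !ltNge F0_ge0 w0.
have id0 : atomless (idR : {RV mu >-> R}).
  by move=> x; rewrite preimage_id mu_set1.
have [|z zp zlt] := quantile id0 p0.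
  by exists 1; rewrite -F0_rcdf F0_1.
exists z; split=> [||w _]; rewrite ?F0_rcdf //.
apply/andP; split.
  by rewrite ltW // -zlt -F0_rcdf F0_0.
by rewrite leNgt -zlt -F0_rcdf F0_1 -leNgt.
Qed.

Lemma pr_itv p q : 0 <= p <= q -> pr `[p, q[%classic = F q - F p.
Proof.
move=> /andP[p0 pq].
have init x : 0 <= x -> F x = pr `[0, x[%classic.
  move=> x0; rewrite /F0 -(@setUitv1 _ _ _ _ true) // measureU0 //.
  exact: mu_set1.
have q0 : 0 <= q by exact: le_trans pq.
rewrite !init // -prD //.
  congr pr; apply/seteqP; split => x /=; rewrite !in_itv /=.
    by move=> /andP[px ->]; rewrite (le_trans p0 px) /= ltNge px.
  by move=> [/andP[x0 xq]] /negP; rewrite x0 xq andbT -leNgt.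
by move=> x /=; rewrite !in_itv /= => /andP[-> /lt_le_trans ->].
Qed.

(** The shape, off the null set [N], of the sublevel sets of a function that
    decreases off [N]. *)
Definition upset N A := [/\ measurableR A, A `<=` I &
  forall x y, (I `\` N) x -> (I `\` N) y -> x < y -> A x -> A y].

(** Two such sets are nested up to the null set, hence differ by a null set as
    soon as they have the same measure. *)
Lemma upset_diff N A B : measurableR N -> mu N = 0%E ->
  upset N A -> upset N B -> pr A = pr B -> pr (A `\` B) = 0.
Proof.
move=> mN N0 [mA AI uA] [mB BI uB] AB.
have null D : measurableR D -> D `<=` N -> pr D = 0.
  by move=> mD DN; rewrite /pr (subset_measure0 mD mN DN).
have [DN|nDN] := pselect (A `\` B `<=` N).
  by apply: null => //; exact: measurableD.
have : B `\` A `<=` N.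
  move=> b [Bb nAb]; apply: contrapT => nNb; apply: nDN => a [Aa nBa].
  apply: contrapT => nNa.
  have [ab|ba|E] := ltgtP a b.
  - by apply: nAb; apply: (uA a b) => //; split=> //; [exact: AI|exact: BI].
  - by apply: nBa; apply: (uB b a) => //; split=> //; [exact: BI|exact: AI].
  - by apply: nBa; rewrite E.
move=> /null BA; have := prDI mu mA mB; have := prDI mu mB mA.
rewrite BA; last exact: measurableD.
by rewrite add0r setIC AB => ->; lra.
Qed.

(** The sublevel sets of the uniform variable [1 - F], of measure [u]. *)
Definition upper u : set R := [set w | 0 <= w <= 1 /\ 1 - u <= F w].

Lemma upperE u : 0 <= u <= 1 ->
  exists z, [/\ 0 <= z <= 1, F z = 1 - u & upper u = `[z, 1]%classic].
Proof.
move=> uI; have [|z [zI Fz zlt]] := @F0_quantile (1 - u); first by lra.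
exists z; split=> //; apply/seteqP; split => w /=; rewrite in_itv /=.
  by move=> [/andP[w0 ->]]; rewrite leNgt zlt // -leNgt => ->.
move=> /andP[zw w1]; have w0 : 0 <= w by lra.
by split; [rewrite w0 w1|rewrite leNgt zlt // -leNgt].
Qed.

Lemma pr_upper_itv z : 0 <= z <= 1 -> pr `[z, 1]%classic = 1 - F z.
Proof.
move=> /andP[z0 z1].
rewrite /pr -(@setUitv1 _ _ _ _ true) // measureU0 //; last exact: mu_set1.
by rewrite -[fine _]/(pr _) pr_itv ?z0 // F0_1.
Qed.

Lemma upset_itv N z : 0 <= z -> upset N `[z, 1]%classic.
Proof.
move=> z0; split=> //.
  by move=> w /=; rewrite !in_itv /= => /andP[/(le_trans z0) ->].
move=> x y _ [/=]; rewrite !in_itv /= => /andP[_ -> _] /ltW xy /andP[zx _].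
by rewrite (le_trans zx).
Qed.

Lemma upset_upper N u : 0 <= u <= 1 -> upset N (upper u).
Proof. by move=> /upperE[z [/andP[z0 _] _ ->]]; exact: upset_itv. Qed.

Lemma pr_upper u : 0 <= u <= 1 -> pr (upper u) = u.
Proof. by move=> /upperE[z [zI Fz ->]]; rewrite pr_upper_itv // Fz; lra. Qed.

Lemma measurable_upper u : 0 <= u <= 1 -> measurableR (upper u).
Proof. by case/(upset_upper set0). Qed.

Lemma at_timeD h A B : at_time h A `\` at_time h B = at_time h (A `\` B).
Proof.
apply/seteqP; split => x /=; rewrite /at_time /=.
  by move=> [[xI xA] nB]; split=> //; split=> // xB; exact: nB.
by move=> [xI [xA nB]]; split=> // -[].
Qed.

(** The measure of the joint event depends only on the measures of the two
    events, as these are determined by their measure up to null sets. *)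
Lemma pr_upset N A A' B B' h : measurableR N -> mu N = 0%E ->
  upset N A -> upset N A' -> upset N B -> upset N B' ->
  pr A = pr A' -> pr B = pr B' ->
  pr (A `&` at_time h B) = pr (A' `&` at_time h B').
Proof.
move=> mN N0 uA uA' uB uB' AA' BB'.
have [mA _ _] := uA; have [mA' _ _] := uA'.
have [mB _ _] := uB; have [mB' _ _] := uB'.
apply: pr_ae => //; rewrite ?at_timeD ?pr_at_time.
all: try exact: measurable_at_time.
all: try exact: measurableD.
all: by apply: (upset_diff mN N0).
Qed.

(** The distribution function of the pair [(1 - F w, 1 - F (T^h w))], whose
    components are uniform. *)
Definition MP_copula h u v : R := pr (upper u `&` at_time h (upper v)).

Lemma upperW u v : u <= v -> upper u `<=` upper v.
Proof. by move=> uv w [wI wu]; split=> //; lra. Qed.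

Lemma upper1 : upper 1 = I.
Proof.
apply/seteqP; split => w /=; rewrite in_itv /=; first by case.
by move=> wI; split=> //; rewrite subrr F0_ge0.
Qed.

Lemma at_timeW h A B : A `<=` B -> at_time h A `<=` at_time h B.
Proof. by move=> AB w [wI /AB]. Qed.

(** The rectangle inequality compares the strips [v1 < 1 - F (T^h w) <= v2] over
    the sublevel sets of [u1] and [u2]. *)
Lemma MP_copula_is_copula h : is_copula (MP_copula h).
Proof.
have mup u : 0 <= u <= 1 -> measurableR (upper u) by exact: measurable_upper.
have mat u : 0 <= u <= 1 -> measurableR (at_time h (upper u)).
  by move=> uI; apply: measurable_at_time; exact: mup.
have mUA u v : 0 <= u <= 1 -> 0 <= v <= 1 ->
    measurableR (upper u `&` at_time h (upper v)).
  by move=> uI vI; apply: measurableI; [exact: mup|exact: mat].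
have I0 : 0 <= (0 : R) <= 1 by rewrite lexx ler01.
have I1 : 0 <= (1 : R) <= 1 by rewrite lexx ler01.
have leL u v : 0 <= u <= 1 -> 0 <= v <= 1 -> MP_copula h u v <= u.
  move=> uI vI; rewrite -[leRHS]pr_upper //.
  by apply: le_pr => //; [exact: mUA|exact: mup].
have leR u v : 0 <= u <= 1 -> 0 <= v <= 1 -> MP_copula h u v <= v.
  move=> uI vI; rewrite -[leRHS]pr_upper // -(pr_at_time h) //; last exact: mup.
  by apply: le_pr => //; [exact: mUA|exact: mat].
have ge0 u v : 0 <= MP_copula h u v by exact: pr_ge0.
split.
- move=> u v; rewrite !in_itv /= => uI vI; rewrite ge0 /=.
  by apply: le_trans (leL _ _ uI vI) _; lra.
- move=> u; rewrite in_itv /= => uI.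
  by split; apply/le_anti; rewrite ge0 andbT; [exact: leR|exact: leL].
- move=> u; rewrite in_itv /= => uI; split.
    rewrite /MP_copula upper1 (_ : upper u `&` _ = upper u) ?pr_upper //.
    apply/setIidl => w [wI _]; split=> /=; rewrite ?in_itv //=.
    exact: iter_MP_unit.
  rewrite /MP_copula upper1 (_ : I `&` _ = at_time h (upper u)).
    by rewrite pr_at_time ?pr_upper //; exact: mup.
  by apply/setIidr => w [].
move=> u1 u2 v1 v2 u10 u12 u21 v10 v12 v21.
have u1I : 0 <= u1 <= 1 by lra.
have u2I : 0 <= u2 <= 1 by lra.
have v1I : 0 <= v1 <= 1 by lra.
have v2I : 0 <= v2 <= 1 by lra.
have strip u : 0 <= u <= 1 -> MP_copula h u v2 - MP_copula h u v1 =
    pr (upper u `&` at_time h (upper v2 `\` upper v1)).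
  move=> uI; rewrite /MP_copula -prD; [|exact: mUA|exact: mUA|].
    congr pr; rewrite -at_timeD; apply/seteqP; split => w.
      by move=> [[wu w2] nw]; split=> //; split=> // w1; exact: nw.
    by move=> [wu [w2 nw]]; split=> // -[].
  by move=> w [wu wv]; split=> //; apply: at_timeW wv; exact: upperW.
have : pr (upper u1 `&` at_time h (upper v2 `\` upper v1)) <=
       pr (upper u2 `&` at_time h (upper v2 `\` upper v1)).
  have mD : measurableR (at_time h (upper v2 `\` upper v1)).
    by apply: measurable_at_time; apply: measurableD; exact: mup.
  apply: le_pr; [by apply: measurableI; [exact: mup|]..|].
  by apply: setSI; exact: upperW.
by rewrite -!strip //; lra.
Qed.

(** * The copula in terms of the nodes *)

Lemma end_point_unit h k : (k <= 2 ^ h)%N -> 0 <= end_point s h k <= 1.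
Proof. exact: full_branched_unit (end_point_full hs h). Qed.

(** The iterate increases on the node, so that the event is the interval from
    the left end to the inverse image of [x], cut at [z]. *)
Lemma pr_node_box h n x z : (n < 2 ^ h)%N -> 0 <= x <= 1 ->
  let a := end_point s h in a n <= z <= a n.+1 ->
  pr (`[a n, z[%classic `&` at_time h `[0, x[%classic) =
  Num.min (F z) (F (inv_branch s h n x)) - F (a n).
Proof.
move=> nN xI a /andP[az za].
have [/andP[ab _] blt] := inv_branchP hs nN xI; rewrite -/a in ab blt.
have /andP[a0 _] : 0 <= a n <= 1 by exact/end_point_unit/ltnW.
have /andP[_ a1] : 0 <= a n.+1 <= 1 by exact: end_point_unit.
set b := inv_branch s h n x in ab blt *.
have -> : Num.min (F z) (F b) = F (Num.min z b).
  by case: (leP z b) => [zb|/ltW bz]; [rewrite min_l|rewrite min_r]; rewrite ?F0_le.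
rewrite -pr_itv ?a0 ?le_min ?az ?ab //.
congr pr; apply/seteqP; split => w /=; rewrite /at_time /= !in_itv /= lt_min.
  move=> [/andP[aw wz] [_ /andP[_ wx]]]; rewrite aw wz /= -blt //.
  by rewrite in_itv /= aw (lt_le_trans wz).
move=> /and3P[aw wz wb].
have wI : 0 <= w <= 1 by lra.
rewrite aw wz wI blt ?wb ?andbT; last by rewrite in_itv /= aw (lt_le_trans wz).
by split=> //; split=> //; have /andP[] := iter_MP_unit hs h wI.
Qed.

(** The nodes below [z] contribute entirely, the node of [z] up to [z]. *)
Lemma pr_box h n x z : (n < 2 ^ h)%N -> 0 <= x <= 1 ->
  let a := end_point s h in a n <= z <= a n.+1 ->
  pr (`[0, z[%classic `&` at_time h `[0, x[%classic) =
  \sum_(0 <= k < n) (F (inv_branch s h k x) - F (a k)) +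
  Num.min (F z) (F (inv_branch s h n x)) - F (a n).
Proof.
move=> nN xI a; elim: n nN z => [|n IH] nN z zn.
  rewrite big_geq // add0r -pr_node_box //; congr (pr (_ `&` _)).
  by have [-> _ _ _] := end_point_full hs h.
have an1 : a n <= a n.+1 <= a n.+1.
  rewrite lexx andbT; apply: (full_branched_mono (end_point_full hs h)) => //.
  exact: ltnW.
have mA : measurableR (at_time h `[0, x[%classic).
  by apply: measurable_at_time; exact: measurable_itv.
have /andP[az _] := zn.
have /andP[a0 _] : 0 <= a n.+1 <= 1 by exact/end_point_unit/ltnW.
rewrite (_ : `[0, z[%classic =
             `[0, a n.+1[%classic `|` `[a n.+1, z[%classic); last first.
  apply/seteqP; split => w /=; rewrite !in_itv /=.
    by move=> /andP[-> ->]; case: (ltP w (a n.+1)) => ?; [left|right].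
  by case=> /andP[]; lra.
rewrite setIUl prU; [|exact: measurableI|exact: measurableI|].
- rewrite pr_node_box // IH //; last exact: ltnW.
  rewrite big_nat_recr //= min_r; first by lra.
  apply: F0_le; have [/andP[_ //] _] := inv_branchP hs (ltnW nN) xI.
- apply/seteqP; split => w //= [[+ _] [+ _]]; rewrite !in_itv /=; lra.
Qed.

(** The sublevel sets are replaced by the intervals [[z, 1]] and [[x, 1]], which
    are closed upwards and have the same measures; the complements in [I] are
    then taken one at a time. *)
Lemma MP_copulaE h z x : 0 <= z <= 1 -> 0 <= x <= 1 ->
  MP_copula h (1 - F z) (1 - F x) =
  1 - F z - F x + pr (`[0, z[%classic `&` at_time h `[0, x[%classic).
Proof.
move=> zI xI; have FI y : 0 <= 1 - F y <= 1.
  by have := F0_ge0 y; have := F0_le1 y; lra.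
have /andP[z0 z1] := zI; have /andP[x0 x1] := xI.
have -> : MP_copula h (1 - F z) (1 - F x) =
    pr (`[z, 1]%classic `&` at_time h `[x, 1]%classic).
  have upE y : 0 <= y <= 1 -> pr (upper (1 - F y)) = pr `[y, 1]%classic.
    by move=> yI; rewrite pr_upper // pr_upper_itv.
  by apply: (@pr_upset set0); rewrite ?measure0 ?upE //;
    solve [exact: upset_itv | apply: upset_upper; exact: FI].
have compl y : 0 <= y <= 1 -> I `\` `[0, y[%classic = `[y, 1]%classic.
  move=> yI; apply/seteqP; split => w /=; rewrite !in_itv /=.
    by move=> [/andP[-> ->]] /negP; rewrite /= andbT -leNgt.
  by move=> /andP[yw w1]; split; lra.
have mz : measurableR `[0, z[%classic by exact: measurable_itv.
have mAx : measurableR (at_time h `[0, x[%classic).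
  by apply: measurable_at_time; exact: measurable_itv.
have m1 : measurableR `[z, 1]%classic by exact: measurable_itv.
have E1 : pr (`[z, 1]%classic `\` at_time h `[0, x[%classic) =
    pr (`[z, 1]%classic `&` at_time h `[x, 1]%classic).
  congr pr; apply/seteqP; split => w /=; rewrite /at_time /= !in_itv /=.
    move=> [zw nw]; have wI : 0 <= w <= 1 by lra.
    have /andP[t0 t1] := iter_MP_unit hs h wI.
    split=> //; split=> //; rewrite t1 andbT leNgt; apply/negP => tx.
    by apply: nw; rewrite t0 tx.
  move=> [zw [wI tw]]; split=> // -[_].
  by move: tw => /andP[xt _]; rewrite ltNge xt andbF.
have E2 : pr (at_time h `[0, x[%classic `\` `[0, z[%classic) =
    pr (`[z, 1]%classic `&` at_time h `[0, x[%classic).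
  rewrite -compl //; congr pr; apply/seteqP; split => w.
    by move=> [[wI tw] nw].
  by move=> [[wI nw] tw].
have D1 := prDI mu m1 mAx; have D2 := prDI mu mAx mz.
rewrite E1 in D1; rewrite E2 pr_at_time // pr_itv ?lexx // F0_0 in D2.
rewrite pr_upper_itv // in D1.
rewrite [X in _ + pr X]setIC; move: D1 D2; lra.
Qed.

Lemma F0invP p : 0 <= p <= 1 -> 0 <= F0inv mu p <= 1 /\ F (F0inv mu p) = p.
Proof.
move=> pI; have [z [zI zp _]] := F0_quantile pI.
have pF : (F @` I) p by exists z; rewrite //= in_itv.
split; last by rewrite /F0inv pinvK ?inE.
have sF : set_surj I [set p] F by move=> _ ->.
have : I (F0inv mu p) by apply: (surjpinv_image_sub sF); exists p.
by rewrite /= in_itv.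
Qed.

Lemma node_indexP h u : 0 <= u <= 1 ->
  let a := end_point s h in let n := node_index s mu h u in
  (n < 2 ^ h)%N /\ F (a n) <= 1 - u <= F (a n.+1).
Proof.
move=> /andP[u0 u1] a; rewrite /node_index -/a.
have [a0 aN _ _] := end_point_full hs h; rewrite -/a in a0 aN.
case: eqVneq => [->|nu0] /=.
  by rewrite prednK ?expn_gt0 // aN F0_1 subr0 F0_le1 lexx.
have u_gt0 : 0 < u by rewrite lt_neqAle eq_sym nu0.
set q := fun k => _.
have hasq : has q (iota 0 (2 ^ h)).
  have : exists k, 1 - u < F (a k).
    by exists (2 ^ h)%N; rewrite aN F0_1; lra.
  case/ex_minnP => -[|k] xk kmin.
    by move: xk; rewrite a0 F0_0; lra.
  have ak : F (a k) <= 1 - u by rewrite leNgt; apply/negP => /kmin; rewrite ltnn.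
  apply/hasP; exists k; last by rewrite /q in_itv /=; lra.
  rewrite mem_iota add0n /=; apply: kmin; rewrite aN F0_1; lra.
have fN : (find q (iota 0 (2 ^ h)) < 2 ^ h)%N.
  by rewrite -[X in (_ < X)%N](size_iota 0) -has_find.
split=> //; have := nth_find 0%N hasq; rewrite nth_iota // add0n /q in_itv /=.
by lra.
Qed.

Lemma MP_copula_formula h u v : 0 <= u <= 1 -> 0 <= v <= 1 ->
  let a := end_point s h in let n := node_index s mu h u in
  MP_copula h u v = u + v - 1 +
    \sum_(0 <= k < n) (calF s mu h k (1 - v) - F (a k)) +
    Num.min (1 - u) (calF s mu h n (1 - v)) - F (a n).
Proof.
move=> uI vI a n; have [nN /andP[an an1]] := node_indexP h uI.
have [|xI Fx] := @F0invP (1 - v); first by lra.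
rewrite -/a -/n in nN an an1.
(* If [F] takes the value [1 - u] at the left end of the node, then the
   quantile may lie in an earlier node, and the left end itself is taken. *)
have [z zn Fz] : exists2 z, a n <= z <= a n.+1 & F z = 1 - u.
  have ale : a n <= a n.+1.
    exact: (full_branched_mono (end_point_full hs h)).
  move: an; rewrite le_eqVlt => /orP[/eqP an|an].
    by exists (a n); rewrite ?lexx.
  have [|z [/andP[z0 _] zE zlt]] := @F0_quantile (1 - u); first by lra.
  have /andP[a0 _] : 0 <= a n <= 1 by exact/end_point_unit/ltnW.
  have /andP[a10 _] : 0 <= a n.+1 <= 1 by exact: end_point_unit.
  exists z => //; rewrite ltW -?zlt //=.
  by rewrite leNgt -zlt // -leNgt.
have /andP[a0 _] : 0 <= a n <= 1 by exact/end_point_unit/ltnW.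
have /andP[_ a11] : 0 <= a n.+1 <= 1 by exact: end_point_unit.
have zI : 0 <= z <= 1 by lra.
have := MP_copulaE h zI xI; rewrite (pr_box nN xI zn) Fz Fx !subKr => ->.
by rewrite /calF /a; lra.
Qed.

End invariant_measure.

(** * Manneville-Pomeau processes *)

Section Manneville_Pomeau_process.
Context {R : realType} (s : R) (hs : 0 < s).
Context (mu : probability (measurableTypeR R) R) (phi : R -> R).
Context {d : measure_display} {Omega : measurableType d}.
Context {P : probability Omega R} {U0 : {RV P >-> R}} {X : nat -> {RV P >-> R}}.
Context (hX : is_MP_process s mu phi U0 X).
Local Notation I := (`[0, 1]%classic : set R).
Local Notation measurableR := (@measurable _ (measurableTypeR R)).
Implicit Types (A B N : set R) (x y u v : R) (t h : nat).

Let hmu : is_MP_measure s mu. Proof. by case: hX. Qed.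

Definition lower x : set R := I `&` phi @^-1` `]-oo, x]%classic.

Lemma measurable_phi_preimage A : measurableR A ->
  measurableR (I `&` phi @^-1` A).
Proof.
have [_ _ _ /measurable_int/measurable_EFinP mphi _] := hX.
by move=> mA; apply: mphi => //; exact: measurable_itv.
Qed.

Lemma measurable_lower x : measurableR (lower x).
Proof. by apply: measurable_phi_preimage; exact: measurable_itv. Qed.

(** The initial point has law [mu], which is invariant under the iterates. *)
Lemma orbit_law t A : measurableR A ->
  P [set w | A (iter t (MP s) (U0 w))] = mu A.
Proof.
move=> mA; have [_ U0law U0I _ _] := hX.
rewrite -(mu_at_time hs hmu t mA) -U0law; last exact: measurable_at_time.
congr (P _); apply/seteqP; split => w /=; rewrite /at_time /=.
  by move=> wA; split=> //; exact: U0I.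
by case.
Qed.

Lemma orbit_unit t w : I (iter t (MP s) (U0 w)).
Proof.
have [_ _ U0I _ _] := hX; have := U0I w.
by rewrite /= !in_itv /=; exact: iter_MP_unit.
Qed.

Lemma joint_law t h x y :
  P [set w | X t w <= x /\ X (t + h)%N w <= y] =
  mu (lower x `&` at_time s h (lower y)).
Proof.
have [_ _ _ _ XE] := hX.
rewrite -(orbit_law t); last first.
  by apply: measurableI; [|apply: measurable_at_time]; exact: measurable_lower.
congr (P _); apply/seteqP; split => w /=; rewrite !XE addnC iterD.
  move=> [wx wy]; split; split; rewrite /= ?in_itv //; first exact: orbit_unit.
    exact: orbit_unit.
  split; rewrite /= ?in_itv //.
  by rewrite -iterD; exact: orbit_unit.
by move=> [[_ /=] + [_ [_ /=]]]; rewrite !in_itv.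
Qed.

Lemma marginal_law t x : cdf (X t) x = mu (lower x).
Proof.
have [_ _ _ _ XE] := hX.
rewrite -(orbit_law t); last exact: measurable_lower.
congr (P _); apply/seteqP; split => w /=; rewrite XE.
  by move=> wx; split=> //; exact: orbit_unit.
by case.
Qed.

(** The joint and marginal laws do not depend on [t], hence neither does the set
    of copulas out of which [copula] chooses. *)
Lemma copula_stationary t h :
  copula (X 0%N) (X h) = copula (X t) (X (t + h)%N).
Proof.
rewrite /copula; congr (xget _ _).
by apply/seteqP; split => C [Ccop CE]; split=> // x y; have := CE x y;
  rewrite !marginal_law joint_law (joint_law 0).
Qed.

Section decreasing.
Context (N : set R) (mN : measurableR N) (N0 : mu N = 0%E).
Context (phi_dec : forall x y, (I `\` N) x -> (I `\` N) y -> x < y ->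
  phi y < phi x).

Lemma upset_lower x : upset N (lower x).
Proof.
split; [exact: measurable_lower|by move=> w []|].
move=> a b aN bN ab [_ /=]; rewrite !in_itv /= => ax; split; first by case: bN.
by rewrite /= in_itv /= (le_trans _ ax) // ltW // phi_dec.
Qed.

(** A strictly decreasing function takes each value at most once off [N]. *)
Lemma process_atomless t : atomless (X t).
Proof.
move=> x; have [_ _ _ _ XE] := hX.
have mA : measurableR (I `&` phi @^-1` [set x]).
  by apply: measurable_phi_preimage; exact: measurable_set1.
have -> : X t @^-1` [set x] =
    [set w | (I `&` phi @^-1` [set x]) (iter t (MP s) (U0 w))].
  apply/seteqP; split => w /=; rewrite XE; last by case.
  by move=> wx; split=> //; exact: orbit_unit.
rewrite orbit_law //.
have [[a [[aI ax] aN]]|none] :=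
  pselect (exists a, (I `&` phi @^-1` [set x]) a /\ ~ N a).
  have mNa : measurableR (N `|` [set a]).
    by apply: measurableU => //; exact: measurable_set1.
  have muNa : mu (N `|` [set a]) = 0%E.
    by rewrite measureU0 //; exact: (mu_set1 hmu).
  apply: (subset_measure0 mA mNa) muNa => b [bI bx].
  have [|bN] := pselect (N b); [by left|right].
  have [ab|ba|//] := ltgtP a b.
    by have := phi_dec (conj aI aN) (conj bI bN) ab; rewrite ax bx ltxx.
  by have := phi_dec (conj bI bN) (conj aI aN) ba; rewrite ax bx ltxx.
apply: (subset_measure0 mA mN) N0 => b bA; apply: contrapT => bN.
by apply: none; exists b.
Qed.

(** The events [phi <= x] and [upper u], with [u] the measure of the former, are
    both closed upwards off [N] and have the same measure. *)
Lemma MP_copula_is_copula_of t h :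
  is_copula_of (X t) (X (t + h)%N) (MP_copula s mu h).
Proof.
split; first exact: MP_copula_is_copula.
move=> x y; rewrite joint_law prE; last first.
  by apply: measurableI; [|apply: measurable_at_time]; exact: measurable_lower.
congr EFin; rewrite !marginal_law -![fine _]/(pr mu _).
have FI z : 0 <= pr mu (lower z) <= 1.
  rewrite pr_ge0 -lee_fin -prE ?probability_le1 //; exact: measurable_lower.
apply: (pr_upset hs hmu h mN N0); rewrite ?(pr_upper hmu) //.
all: solve [exact: upset_lower | exact: (upset_upper hmu)].
Qed.

End decreasing.

End Manneville_Pomeau_process.

Theorem proposition3p3 (R : realType) (s : R) (hs : 0 < s < 1)
    (mu : probability (measurableTypeR R) R) (phi : R -> R)
    (d : measure_display) (Omega : measurableType d)
    (P : probability Omega R) (U0 : {RV P >-> R})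
    (X : nat -> {RV P >-> R})
    (hX : is_MP_process s mu phi U0 X)
    (hphi : ae_decreasing phi)
    (t h : nat) (hh : h <> 0%N) :
  (forall u v : R, u \in `[0, 1] -> v \in `[0, 1] ->
     copula (X 0%N) (X h) u v = copula (X t) (X (t + h)%N) u v) /\
  (forall u v : R, u \in `[0, 1] -> v \in `[0, 1] ->
     let a := end_point s h in
     let n0 := node_index s mu h u in
     copula (X t) (X (t + h)%N) u v =
       u + v - 1
       + (\sum_(0 <= k < n0) (calF s mu h k (1 - v) - F0 mu (a k)))
           * (0 < n0)%N%:R
       + Num.min (1 - u) (calF s mu h n0 (1 - v)) - F0 mu (a n0)).
Proof.
have /andP[s0 _] := hs.
split=> u v uI vI; first by rewrite (copula_stationary s0 hX t h).
move=> a n0; have [hmu _ _ _ _] := hX.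
have [N0 [N [mN lN N0N]] dec] := hphi.
have muN := mu_null hmu mN lN.
have phi_dec x y : (`[0, 1]%classic `\` N) x -> (`[0, 1]%classic `\` N) y ->
    x < y -> phi y < phi x.
  by move=> [xI xN] [yI yN]; apply: dec; split=> // /N0N.
have X0 := process_atomless s0 hX mN muN phi_dec.
have Cop := MP_copula_is_copula_of s0 hX mN muN phi_dec t h.
rewrite (copulaE (X0 t) (X0 (t + h)%N) Cop) //.
move: uI vI; rewrite !in_itv /= => uI vI.
rewrite (MP_copula_formula s0 hmu h uI vI) -/a -/n0.
by case: n0 => [|n]; [rewrite big_geq // mul0r|rewrite mulr1].
Qed.
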